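(* Let $k\ge 2$ be fixed. Asymptotically almost surely (i.e. with probability tending to $1$ as $n\to\infty$), $T\sim\mathcal{R}(n,k)$ has the property that every minimal feedback arc set of $T$ contains $n-k+1$ pairwise vertex-disjoint $k$-cliques.
   Context: $\mathcal{R}(n,k)$ denotes the probability space of $k$-partite tournaments with vertex classes $A_1,\ldots,A_k$, each of size $n$, where every edge between distinct classes is oriented independently and uniformly at random. A feedback arc set of a directed graph $T$ is a set of edges (viewed as a spanning subgraph) meeting every directed cycle; it is minimal if no proper subset of it is a feedback arc set. A $k$-clique in a feedback arc set $H$ is a set of $k$ vertices that are pairwise adjacent in $H$. *)

(* Defs.v *)
From HB Require Import structures.
From mathcomp Require Import all_boot all_order all_algebra.
From Stdlib Require Import ClassicalEpsilon.
Set Implicit Arguments. Unset Strict Implicit. Unset Printing Implicit Defensive.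
Import Order.TTheory GRing.Theory Num.Theory.

(* Vertices of a k-partite tournament with classes A_1..A_k of size n:
   a vertex is (i, j) meaning the j-th vertex of class A_i. *)
Definition vtx (k n : nat) := ('I_k * 'I_n)%type.

(* Pairs of vertices (u, v) with class u < class v: exactly one such
   representative for every unordered pair of vertices in distinct classes. *)
Definition cpair (k n : nat) :=
  {p : vtx k n * vtx k n | (nat_of_ord p.1.1 < nat_of_ord p.2.1)%N}.

(* A k-partite tournament in R(n,k) is given by an orientation of every
   cross pair: o p = true means p.1 -> p.2, false means p.2 -> p.1.
   The uniform measure on {ffun cpair k n -> bool} is exactly R(n,k). *)
Definition orientation (k n : nat) := {ffun cpair k n -> bool}.

Definition arc (k n : nat) (o : orientation k n) (u v : vtx k n) : bool :=
  match @idP (nat_of_ord u.1 < nat_of_ord v.1)%N with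
  | ReflectT h => o (exist _ (u, v) h)
  | ReflectF _ =>
    match @idP (nat_of_ord v.1 < nat_of_ord u.1)%N with
    | ReflectT h => ~~ o (exist _ (v, u) h)
    | ReflectF _ => false
    end
  end.

Definition directed_cycle (T : finType) (e : rel T) (s : seq T) : bool :=
  [&& s != [::], uniq s & cycle e s].

Definition feedback_arc_set (T : finType) (e : rel T) (H : {set T * T}) : Prop :=
  (forall a : T * T, a \in H -> e a.1 a.2) /\
  (forall s : seq T, directed_cycle e s ->
     ~~ cycle (fun x y => (x, y) \notin H) s).

Definition minimal_feedback_arc_set (T : finType) (e : rel T)
    (H : {set T * T}) : Prop :=
  feedback_arc_set e H /\
  (forall H' : {set T * T}, H' \proper H -> ~ feedback_arc_set e H').

Definition adjH (T : finType) (H : {set T * T}) (x y : T) : bool :=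
  ((x, y) \in H) || ((y, x) \in H).

Definition is_clique (T : finType) (H : {set T * T}) (k : nat) (C : {set T}) : Prop :=
  #|C| = k /\ (forall x y, x \in C -> y \in C -> x != y -> adjH H x y).

Definition has_disjoint_cliques (T : finType) (H : {set T * T}) (k m : nat) : Prop :=
  exists C : 'I_m -> {set T},
    (forall i, is_clique H k (C i)) /\
    (forall i j, i != j -> [disjoint C i & C j]).

Definition good_tournament (k n : nat) (o : orientation k n) : Prop :=
  forall H : {set vtx k n * vtx k n},
    minimal_feedback_arc_set (arc o) H ->
    has_disjoint_cliques H k (n - k + 1).

Definition pbool (P : Prop) : bool :=
  if excluded_middle_informative P then true else false.

Definition prob_R (k n : nat) (P : orientation k n -> Prop) : rat :=
  (#|[set o : orientation k n | pbool (P o)]|%:R / #|{: orientation k n}|%:R)%R.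

(* Main.v *)
Require Import Defs.
From mathcomp Require Import all_boot all_order all_algebra.
From mathcomp Require Import zify ring lra.
From Stdlib Require Import ClassicalEpsilon.
(* [path.arc] would otherwise shadow [Defs.arc]. *)
Import Defs.
Set Implicit Arguments. Unset Strict Implicit. Unset Printing Implicit Defensive.
Import Order.TTheory GRing.Theory Num.Theory.

(** The complement of a feedback arc set [H] is acyclic, so there is a rank
    function on the vertices all of whose backward arcs lie in [H].  With
    [r ~ n^(1/4)] and [s = 2^k r], two properties hold with high probability.
    First, for any [s] disjoint transversals and [s] vertices of a class, some
    vertex is [H]-adjacent to all the other coordinates of some transversal:
    splitting at medians of the rank fixes the direction that each arc has to have,
    and [r^2] arc-disjoint stars never all miss a given pattern.  Second, for
    distinct [u], [v] outside a class, many [x] in it satisfy [u -> x -> v]; if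
    [u] and [v] both had few [H]-neighbours in the class then [u] would rank below
    [v] and [v] below [u].  So each class has at most one low-degree vertex
    outside it, and deleting [k-1] vertices from every class removes them all.
    The remaining vertices are tiled perfectly by absorption: reserve a family [Q]
    of disjoint cliques, cover the few vertices that can be exchanged into few
    members of [Q], extend greedily, and insert the leftovers [k] at a time, the
    vertices they replace in [Q] being chosen to form a clique. *)

(** * Counting orientations that miss a pattern on disjoint blocks of edges *)

(** Disjoint blocks are independent, and a block of at most [k] edges misses its pattern with
    probability at most [1 - 2^-k]; denominators are cleared. In the induction, overwriting block
    [a] by the pattern does not disturb the other blocks. *)
Lemma card_avoid_blocks (E J : finType) (k : nat) (blk : J -> {set E})
    (pat : E -> bool) (A : seq J) :
  uniq A -> (forall a, #|blk a| <= k) ->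
  (forall a b, a != b -> [disjoint blk a & blk b]) ->
  #|[set o : {ffun E -> bool} |
      all (fun a => [exists e in blk a, o e != pat e]) A]| * (2 ^ k) ^ size A
  <= (2 ^ k - 1) ^ size A * 2 ^ #|E|.
Proof.
move=> uA hk hd; elim: A uA => [|a A IH] /=.
  rewrite !expn0 muln1 mul1n => _; apply: leq_trans (max_card _) _.
  by rewrite card_ffun card_bool.
case/andP=> aA uA; have {}IH := IH uA.
set Bad := [set o : {ffun E -> bool} | _] in IH.
set hit := fun o : {ffun E -> bool} => [exists e in blk a, o e != pat e].
have -> : [set o : {ffun E -> bool} | hit o &&
    all (fun a => [exists e in blk a, o e != pat e]) A] = Bad :&: [set o | hit o].
  by apply/setP=> o; rewrite !inE andbC.
set N := #|Bad :&: _|.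
pose Mt := Bad :\: [set o | hit o].
have hB : #|Bad| = N + #|Mt| by rewrite -(cardsID [set o | hit o] Bad).
have hM : #|Bad| <= #|Mt| * 2 ^ k.
  (* The second component keeps the overwritten values, so [phi] is injective and at most [2 ^ k]
     members of [Bad] share a first component. *)
  pose phi (o : {ffun E -> bool}) : {ffun E -> bool} * {set E} :=
    ([ffun e => if e \in blk a then pat e else o e], [set e in blk a | o e]).
  have phiI : injective phi.
    move=> o o' [/ffunP h1 /setP h2]; apply/ffunP=> e.
    have := h1 e; have := h2 e; rewrite !inE !ffunE.
    by case: (e \in blk a).
  have phiS : phi @: Bad \subset setX Mt (powerset (blk a)).
    apply/subsetP=> _ /imsetP[o oB ->]; rewrite !inE /=; apply/andP; split; last first.
      by apply/subsetP=> e; rewrite inE => /andP[].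
    apply/andP; split.
      rewrite /hit negb_exists; apply/forallP=> e; rewrite ffunE.
      by case: (e \in blk a) => //=; rewrite eqxx.
    apply/allP=> b bA; move: oB; rewrite inE => /allP/(_ b bA).
    case/existsP=> e /andP[eb he]; apply/existsP; exists e; rewrite eb ffunE.
    have ab : a != b by apply: contraNneq aA => ->.
    by rewrite (disjointFl (hd _ _ ab) eb).
  rewrite -(card_imset _ phiI); apply: leq_trans (subset_leq_card phiS) _.
  by rewrite cardsX card_powerset leq_mul2l leq_exp2l // hk orbT.
have hN : N * 2 ^ k <= (2 ^ k - 1) * #|Bad|.
  by rewrite mulnBl mul1n [2 ^ k * _]mulnC {1}hB mulnDl -addnBA // leq_addr.
rewrite !expnS mulnA; apply: leq_trans (leq_mul hN (leqnn _)) _.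
by rewrite -!mulnA leq_mul2l IH orbT.
Qed.

Lemma arc_ltE (k n : nat) (o : orientation k n) (u v : vtx k n)
    (h : (u.1 < v.1)%N) : arc o u v = o (exist _ (u, v) h).
Proof.
rewrite /arc; case: {-}_ / idP => [h'|//].
by congr (o _); congr exist; apply: bool_irrelevance.
Qed.

Lemma arc_gtE (k n : nat) (o : orientation k n) (u v : vtx k n)
    (h : (v.1 < u.1)%N) : arc o u v = ~~ o (exist _ (v, u) h).
Proof.
rewrite /arc; case: {-}_ / idP => [h'|_]; first by have := ltn_trans h h'; rewrite ltnn.
case: {-}_ / idP => [h'|//].
by congr (~~ (o _)); congr exist; apply: bool_irrelevance.
Qed.

Lemma arcC (k n : nat) (o : orientation k n) (u v : vtx k n) :
  u.1 != v.1 -> arc o v u = ~~ arc o u v.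
Proof.
rewrite neq_ltn => /orP[h|h].
  by rewrite (arc_ltE o h) (arc_gtE o h).
by rewrite (arc_ltE o h) (arc_gtE o h) negbK.
Qed.

(** Leaves lie outside class [j] and centres inside it, so stars with different centres share no
    edge; stars with a common centre have disjoint leaves. A true [dir y] asks for the arc from the
    leaf [y] to the centre. *)
Lemma card_avoid_stars (k n c : nat) (J : finType) (j : 'I_k) (w : J -> 'I_n)
    (Y : J -> {set vtx k n}) (dir : vtx k n -> bool) :
  (forall a, #|Y a| <= c) -> (forall a y, y \in Y a -> y.1 != j) ->
  (forall a b, a != b -> w a = w b -> [disjoint Y a & Y b]) ->
  #|[set o : orientation k n |
      [forall a, exists y in Y a, arc o y (j, w a) != dir y]]| * (2 ^ c) ^ #|J|
  <= (2 ^ c - 1) ^ #|J| * #|{: orientation k n}|.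
Proof.
move=> hc hj hd.
(* An edge is stored with its lower class first, so the centre may be either entry; the pattern is
   negated when it is the first one. *)
pose other (e : cpair k n) := if (val e).1.1 == j then (val e).2 else (val e).1.
pose center (e : cpair k n) := if (val e).1.1 == j then (val e).1 else (val e).2.
pose blk a := [set e : cpair k n | (center e == (j, w a)) && (other e \in Y a)].
pose pat (e : cpair k n) := if (val e).1.1 == j then ~~ dir (val e).2 else dir (val e).1.
have blkc a : #|blk a| <= c.
  apply: leq_trans (hc a).
  have oi : {in blk a &, injective other}.
    move=> [[x y] h] [[x' y'] h']; rewrite !inE /center /other /=; have hh := h; have hh' := h'; rewrite /= in hh hh'.
    move=> /andP[/eqP c1 o1] /andP[/eqP c2 o2] E; apply: val_inj => /=.
    move: c1 c2 o1 o2 E; case: ifP => e1; case: ifP => e2 c1 c2 o1 o2 E.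
    - by rewrite c1 c2 E.
    - by move: hh'; rewrite c2 -E -(eqP e1) ltnNge ltnW.
    - by move: hh; rewrite c1 E -(eqP e2) ltnNge ltnW.
    - by rewrite c1 c2 E.
  rewrite -(card_in_imset oi); apply: subset_leq_card.
  by apply/subsetP=> _ /imsetP[e he ->]; move: he; rewrite inE => /andP[].
have blkd a b : a != b -> [disjoint blk a & blk b].
  move=> ab; rewrite -setI_eq0; apply/eqP/setP=> e; rewrite !inE.
  apply/negP=> /andP[/andP[/eqP c1 o1] /andP[/eqP c2 o2]].
  have ww : w a = w b by rewrite c1 in c2; case: c2.
  by rewrite (disjointFr (hd _ _ ab ww) o1) in o2.
have := card_avoid_blocks pat (enum_uniq J) blkc blkd.
rewrite -cardE card_ffun card_bool; apply: leq_trans.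
rewrite leq_mul2r; apply/orP; right; apply: subset_leq_card.
apply/subsetP=> o; rewrite !inE => /forallP ho; apply/allP=> a _.
have /existsP[y /andP[yY hy]] := ho a; apply/existsP.
have := hj _ _ yY; rewrite neq_ltn => /orP[h|h].
  have h' : (y.1 < ((j, w a) : vtx k n).1)%N by [].
  exists (exist _ (y, (j, w a)) h'); rewrite !inE /center /other /pat /=.
  by rewrite (negbTE (hj _ _ yY)) eqxx yY -(arc_ltE o h').
have h' : (((j, w a) : vtx k n).1 < y.1)%N by [].
exists (exist _ ((j, w a), y) h'); rewrite !inE /center /other /pat /=.
by move: hy; rewrite !eqxx yY (arc_gtE o h') /=; case: (o _); case: (dir y).
Qed.

(** * Greedy selection in finite sets *)

Lemma subset_of_card (A : finType) (S : {set A}) (s : nat) :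
  s <= #|S| -> exists2 S' : {set A}, S' \subset S & #|S'| = s.
Proof.
move=> hs; exists [set x in take s (enum S)].
  by apply/subsetP=> x; rewrite inE => /mem_take; rewrite mem_enum.
rewrite cardsE (card_uniqP _) ?take_uniq ?enum_uniq // size_takel //.
by rewrite -cardE.
Qed.

(** Greedy: while fewer than [N] edges are chosen, at least [s] vertices on each side are unmatched,
    which yields another edge. The successor in the size bounds reflects that only [N - 1] edges
    precede the last one. *)
Lemma matching_of_edges (A B : finType) (e : A -> B -> bool) (s : nat)
    (S : {set A}) (T : {set B}) (N : nat) :
  (forall (S' : {set A}) (T' : {set B}), S' \subset S -> T' \subset T -> #|S'| = s -> #|T'| = s ->
     exists a b, [/\ a \in S', b \in T' & e a b]) ->
  N + s <= #|S|.+1 -> N + s <= #|T|.+1 ->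
  exists M : {set A * B}, [/\ #|M| = N,
    {in M &, injective (@fst A B)}, {in M &, injective (@snd A B)} &
    forall p, p \in M -> [/\ p.1 \in S, p.2 \in T & e p.1 p.2]].
Proof.
move=> edge; elim: N => [|N IH] hS hT.
  exists set0; split; first exact: cards0.
  - by move=> x y; rewrite inE.
  - by move=> x y; rewrite inE.
  - by move=> x; rewrite inE.
have [||M [cM iA iB hM]] := IH; try lia.
pose S1 := S :\: [set p.1 | p in M]; pose T1 := T :\: [set p.2 | p in M].
have cS : s <= #|S1|.
  have h : #|S :&: [set p.1 | p in M]| <= N.
    by rewrite -cM (leq_trans (subset_leq_card (subsetIr _ _))) ?leq_imset_card.
  by rewrite cardsD; lia.
have cT : s <= #|T1|.
  have h : #|T :&: [set p.2 | p in M]| <= N.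
    by rewrite -cM (leq_trans (subset_leq_card (subsetIr _ _))) ?leq_imset_card.
  by rewrite cardsD; lia.
have [S2 S2s S2c] := subset_of_card cS; have [T2 T2s T2c] := subset_of_card cT.
have [||a [b [aS bT eab]]] := edge S2 T2 _ _ S2c T2c.
- exact: subset_trans S2s (subsetDl _ _).
- exact: subset_trans T2s (subsetDl _ _).
have {aS} := subsetP S2s _ aS; rewrite !inE => /andP[aM aS].
have {bT} := subsetP T2s _ bT; rewrite !inE => /andP[bM bT].
have nM p : p \in M -> (p.1 == a = false) * (p.2 == b = false).
  move=> pM; split; apply/negP=> /eqP E.
    by move/negP: aM; apply; rewrite -E imset_f.
  by move/negP: bM; apply; rewrite -E imset_f.
exists ((a, b) |: M); split.
- rewrite cardsU1 cM; case: (boolP ((a, b) \in M)) => // /nM[].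
  by rewrite /= eqxx.
- move=> p p'; rewrite !inE => /orP[/eqP->|pM] /orP[/eqP->|pM'] //=.
  + by move=> E; have [] := nM _ pM'; rewrite -E eqxx.
  + by move=> E; have [] := nM _ pM; rewrite E eqxx.
  + exact: iA.
- move=> p p'; rewrite !inE => /orP[/eqP->|pM] /orP[/eqP->|pM'] //=.
  + by move=> E; have [_] := nM _ pM'; rewrite -E eqxx.
  + by move=> E; have [_] := nM _ pM; rewrite E eqxx.
  + exact: iB.
- by move=> p; rewrite !inE => /orP[/eqP->|/hM].
Qed.

(** Greedy: the indices treated earlier use up at most [(#|I| - 1) * c] elements. Untreated indices
    start with the empty set, so disjointness can be maintained for all pairs. *)
Lemma disjoint_subsets (I A : finType) (c : nat) (F : I -> {set A}) :
  (forall i, #|I| * c <= #|F i|) ->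
  exists G : I -> {set A}, [/\ forall i, G i \subset F i, forall i, #|G i| = c &
    forall i j, i != j -> [disjoint G i & G j]].
Proof.
move=> hF.
suff [G [hG _ hd]] : exists G : I -> {set A},
    [/\ forall i, i \in enum I -> G i \subset F i /\ #|G i| = c,
        #|\bigcup_i G i| <= size (enum I) * c
      & forall i j, i != j -> [disjoint G i & G j]].
  by exists G; split=> // i; have [] := hG i (mem_enum _ i).
have : size (enum I) <= #|I| by rewrite -cardE.
elim: (enum I) (enum_uniq I) => [|a l IH] /= => [_ _|/andP[al ul] hl].
  exists (fun=> set0); split=> //; last by move=> i j _; rewrite -setI_eq0 set0I.
  by rewrite big1 ?cards0.
have [G [hG hc hd]] := IH ul (ltnW hl).
have [|X XF Xc] := @subset_of_card _ (F a :\: \bigcup_i G i) c.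
  have h1 := leq_trans (subset_leq_card (subsetIr (F a) (\bigcup_i G i))) hc.
  have h2 : (size l).+1 * c <= #|F a| by apply: leq_trans (hF a); rewrite leq_mul2r hl orbT.
  by rewrite mulSn in h2; rewrite cardsD; lia.
have Xd i : [disjoint X & G i].
  rewrite -setI_eq0; apply/eqP/setP=> x; rewrite !inE; apply/negP=> /andP[xX xG].
  have := subsetP XF _ xX; rewrite !inE => /andP[/negP[]].
  by apply/bigcupP; exists i.
exists (fun i => if i == a then X else G i); split.
- move=> i; rewrite inE; case: eqP => [->|_] /= => [_|]; last exact: hG.
  by split=> //; apply: subset_trans XF (subsetDl _ _).
- have sub : \bigcup_i (if i == a then X else G i) \subset X :|: \bigcup_i G i.
    apply/bigcupsP=> i _; case: ifP => _; first exact: subsetUl.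
    by apply: subset_trans (subsetUr _ _); apply: (bigcup_sup i).
  apply: leq_trans (subset_leq_card sub) _.
  by rewrite mulSn cardsU Xc; lia.
- move=> i j ij; case: eqP => [ia|_]; case: eqP => [ja|_].
  + by rewrite ia ja eqxx in ij.
  + exact: Xd.
  + by rewrite disjoint_sym Xd.
  + exact: hd.
Qed.

(** * Perfect tilings by transversal cliques, via absorption *)

Section Tiling.

Variables (k n : nat) (adj : rel (vtx k n)).
Hypothesis adjC : symmetric adj.
Hypothesis k_gt0 : 0 < k.

Local Notation tup := {ffun 'I_k -> 'I_n}.

(** A tuple [f] encodes the transversal with vertices [(i, f i)], so disjointness is
    coordinatewise. *)
Definition pairwise_disjoint (S : {set tup}) : Prop :=
  forall f g, f \in S -> g \in S -> f != g -> forall i, f i != g i.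

Definition transversal_clique (f : tup) : Prop :=
  forall i j, i != j -> adj (i, f i) (j, f j).

Definition upd (f : tup) (j : 'I_k) (v : 'I_n) : tup :=
  [ffun i => if i == j then v else f i].

(* The coordinate [f j] is ignored: [v] is meant to replace it. *)
Definition joins (f : tup) (j : 'I_k) (v : 'I_n) : bool :=
  [forall i, (i != j) ==> adj (i, f i) (j, v)].

(** Apart from a minimum degree, this is the only pseudorandomness that the tiling argument draws
    on. *)
Definition joinable (s : nat) : Prop :=
  forall (j : 'I_k) (S : {set tup}) (T : {set 'I_n}),
    pairwise_disjoint S -> #|S| = s -> #|T| = s ->
    exists f v, [/\ f \in S, v \in T & joins f j v].

Lemma joinsP (f : tup) (j : 'I_k) (v : 'I_n) :
  reflect (forall i, i != j -> adj (i, f i) (j, v)) (joins f j v).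
Proof. exact: 'forall_implyP. Qed.

Definition covered (i : 'I_k) (S : {set tup}) : {set 'I_n} := [set f i | f : tup in S].

Lemma disjoint_inj (S : {set tup}) (i : 'I_k) :
  pairwise_disjoint S -> {in S &, injective (fun f : tup => f i)}.
Proof.
move=> dS f g fS gS /eqP fg; apply/eqP; apply: contraTT fg => h.
exact: dS.
Qed.

Lemma card_covered (S : {set tup}) (i : 'I_k) :
  pairwise_disjoint S -> #|covered i S| = #|S|.
Proof. by move=> dS; rewrite card_in_imset //; apply: disjoint_inj. Qed.

Lemma pairwise_disjointS (S S' : {set tup}) :
  S' \subset S -> pairwise_disjoint S -> pairwise_disjoint S'.
Proof. by move=> /subsetP sub dS f g /sub fS /sub gS; apply: dS. Qed.

Lemma clique_upd (f : tup) (j : 'I_k) (v : 'I_n) :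
  transversal_clique f -> joins f j v -> transversal_clique (upd f j v).
Proof.
move=> cf /joinsP hj i i' ii'; rewrite !ffunE.
case: (i =P j) => [ij|/eqP ij]; case: (i' =P j) => [ij'|/eqP ij'].
- by rewrite ij ij' eqxx in ii'.
- by rewrite adjC ij hj.
- by rewrite ij' hj.
- exact: cf.
Qed.

Variable s : nat.
Hypothesis s_gt0 : 0 < s.
Hypothesis js : joinable s.

(* Coordinate [j] is rematched so as to be joined to all the other coordinates;
   later stages only change coordinates after [j]. *)
Lemma partial_cliques (X : 'I_k -> {set 'I_n}) (j : nat) :
  (forall i, k.+1 * s <= #|X i|) -> j <= k ->
  exists S : {set tup}, [/\ pairwise_disjoint S,
    (k.+1 - j) * s <= #|S|, forall f, f \in S -> forall i, f i \in X i &
    forall f, f \in S -> forall i i' : 'I_k, i < j -> i' < j -> i != i' ->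
      adj (i, f i) (i', f i')].
Proof.
move=> hX; elim: j => [|j IH] hj.
  (* Enumerating all the [X i] in parallel gives the initial [k.+1 * s] disjoint transversals. *)
  pose F (a : 'I_(k.+1 * s)) : tup :=
    [ffun i => enum_val (widen_ord (hX i) a)].
  have FE a b i : F a i = F b i -> a = b.
    by rewrite !ffunE => /enum_val_inj/(congr1 val) /= h; apply: val_inj.
  exists (F @: setT); split=> //.
  - move=> _ _ /imsetP[a _ ->] /imsetP[b _ ->] ab i; apply: contraNneq ab.
    by move=> /FE ->.
  - rewrite card_imset ?cardsT ?card_ord ?subn0 // => a b ab.
    by apply: (FE a b (Ordinal k_gt0)); rewrite ab.
  - by move=> _ /imsetP[a _ ->] i; rewrite ffunE enum_valP.
have [S [dS cS SX aS]] := IH (ltnW hj).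
pose j0 := Ordinal hj.
have cT := card_covered j0 dS.
have e : k.+1 - j = (k.+1 - j.+1).+1 by lia.
(* The guaranteed number of tuples drops by [s] at each stage, so [s] remain after all [k]
   stages. *)
have [|||M [cM iA iB hM]] := @matching_of_edges _ _ (fun f v => joins f j0 v) s S
  (covered j0 S) ((k.+1 - j.+1) * s).
- move=> S' T' S'S _ cS' cT'; apply: js => //.
  exact: pairwise_disjointS dS.
- by move: cS; rewrite e mulSn addnC => /leqW.
- by rewrite cT; move: cS; rewrite e mulSn addnC => /leqW.
pose u (p : tup * 'I_n) := upd p.1 j0 p.2.
have udisj p q : p \in M -> q \in M -> p != q -> forall i, u p i != u q i.
  move=> pM qM pq i; rewrite !ffunE; case: (i =P j0) => _.
    by apply: contraNneq pq => /(iB _ _ pM qM) ->.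
  have [pS _ _] := hM _ pM; have [qS _ _] := hM _ qM.
  by apply: dS => //; apply: contraNneq pq => /(iA _ _ pM qM) ->.
exists (u @: M); split.
- move=> _ _ /imsetP[p pM ->] /imsetP[q qM ->] pq i; apply: udisj => //.
  by apply: contraNneq pq => ->.
- rewrite card_in_imset ?cM // => p q pM qM E; apply/eqP; apply: contraT => pq.
  by have := udisj _ _ pM qM pq j0; rewrite E eqxx.
- move=> _ /imsetP[p pM ->] i; have [pS pT _] := hM _ pM; rewrite ffunE.
  case: (i =P j0) => [->|_]; last exact: SX.
  by case/imsetP: pT => f fS ->; apply: SX.
- move=> _ /imsetP[p pM ->] i i' hi hi' ii'; have [pS pT /joinsP pj] := hM _ pM.
  rewrite !ffunE; case: (i =P j0) => [ij|/eqP ij]; case: (i' =P j0) => [ij'|/eqP ij'].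
  + by rewrite ij ij' eqxx in ii'.
  + by rewrite adjC ij pj.
  + by rewrite ij' pj.
  + apply: aS => //.
    * by move: ij hi; rewrite -val_eqE /= ltnS leq_eqVlt => /negbTE->.
    * by move: ij' hi'; rewrite -val_eqE /= ltnS leq_eqVlt => /negbTE->.
Qed.

Lemma exists_clique (X : 'I_k -> {set 'I_n}) :
  (forall i, k.+1 * s <= #|X i|) ->
  exists2 f : tup, transversal_clique f & forall i, f i \in X i.
Proof.
move=> hX; have [S [_ cS SX aS]] := partial_cliques hX (leqnn k).
have /card_gt0P[f fS] : 0 < #|S| by apply: leq_trans cS; rewrite subSnn mul1n.
by exists f; [move=> i j; apply: aS | apply: SX].
Qed.

Variables (U : 'I_k -> {set 'I_n}) (m : nat).
Hypothesis cU : forall i, #|U i| = m.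

(* [c] vertices in every class force a clique; of the [L] cliques into which a
   typical vertex can be exchanged, half are reserved for earlier exchanges. *)
Local Notation c := (k.+1 * s).
Local Notation L := (2 * (k * c)).
Local Notation q := (s * L.+1).

Definition tiling (S : {set tup}) : Prop :=
  pairwise_disjoint S /\
  forall f, f \in S -> transversal_clique f /\ forall i, f i \in U i.

Lemma tiling_add (S : {set tup}) (f : tup) :
  tiling S -> transversal_clique f -> (forall i, f i \in U i :\: covered i S) ->
  tiling (f |: S).
Proof.
move=> [dS hS] cf hf; split.
  move=> g h; rewrite !inE => /orP[/eqP->|gS] /orP[/eqP->|hS'] gh i.
  - by rewrite eqxx in gh.
  - by have := hf i; rewrite inE => /andP[/negP nf _]; apply/negP=> /eqP E; apply: nf;
      rewrite E; apply: imset_f.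
  - by have := hf i; rewrite inE => /andP[/negP nf _]; apply/negP=> /eqP E; apply: nf;
      rewrite -E; apply: imset_f.
  - exact: dS.
move=> g; rewrite !inE => /orP[/eqP->|/hS //]; split=> // i.
by have := hf i; rewrite inE => /andP[].
Qed.

Lemma card_uncovered (S : {set tup}) (i : 'I_k) (X : {set 'I_n}) (N : nat) :
  pairwise_disjoint S -> #|S| + N <= #|X| -> N <= #|X :\: covered i S|.
Proof.
move=> dS h; rewrite cardsD.
have := subset_leq_card (subsetIr X (covered i S)).
by rewrite card_covered //; lia.
Qed.

Lemma tiling_extend (S : {set tup}) :
  tiling S -> #|S| + c <= m -> exists2 f, f \notin S & tiling (f |: S).
Proof.
move=> tS hc; have [dS _] := tS.
have [|f cf hf] := @exists_clique (fun i => U i :\: covered i S).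
  by move=> i; apply: card_uncovered => //; rewrite cU.
exists f; last exact: tiling_add.
apply/negP=> fS; have := hf (Ordinal k_gt0); rewrite inE => /andP[/negP nf _].
by apply: nf; apply: imset_f.
Qed.

Lemma tiling_grow (S : {set tup}) (N : nat) :
  tiling S -> #|S| <= N -> N + c <= m ->
  exists S' : {set tup}, [/\ S \subset S', tiling S' & #|S'| = N].
Proof.
move=> tS hS; rewrite -(subnK hS); elim: (N - #|S|) => [|d IH] h.
  by exists S; rewrite subxx.
have [|S' [SS' tS' cS']] := IH; first by lia.
have [|f fS tf] := tiling_extend tS'; first by lia.
exists (f |: S'); split=> //; first exact: subset_trans SS' (subsetUr _ _).
by rewrite cardsU1 fS cS'.
Qed.

(** A clique is found among uncovered vertices, adjacent to [x] in the other classes and arbitrary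
    in class [i]; its vertex in class [i] is then exchanged for [x]. *)
Lemma tiling_extend_at (S : {set tup}) (i : 'I_k) (x : 'I_n) :
  tiling S -> x \in U i ->
  (forall j, j != i -> #|S| + c <= #|[set y in U j | adj (i, x) (j, y)]|) ->
  #|S| + c <= m ->
  exists S' : {set tup}, [/\ S \subset S', tiling S', #|S'| <= #|S|.+1 & x \in covered i S'].
Proof.
move=> tS xU hN hm; have [dS _] := tS.
case: (boolP (x \in covered i S)) => [xS|xS]; first by exists S; rewrite subxx.
pose X j := if j == i then U i else [set y in U j | adj (i, x) (j, y)].
have [|f cf hf] := @exists_clique (fun j => X j :\: covered j S).
  move=> j; apply: card_uncovered => //; rewrite /X.
  by case: ifP => [_|/negbT /hN //]; rewrite cU.
have jf : joins f i x.
  apply/joinsP=> j ji; have := hf j; rewrite /X (negbTE ji) !inE.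
  by rewrite [adj (j, _) _]adjC => /and3P[].
exists (upd f i x |: S); split.
- exact: subsetUr.
- apply: tiling_add => //; first exact: clique_upd.
  move=> j; rewrite ffunE; case: (j =P i) => [->|/eqP ji]; first by rewrite inE xS.
  by have := hf j; rewrite /X (negbTE ji) !inE => /and3P[-> ->].
- by rewrite cardsU1; case: (_ \notin _); lia.
- by apply/imsetP; exists (upd f i x); rewrite ?setU11 // ffunE eqxx.
Qed.

(** Each listed vertex costs at most one new clique, hence the term [size l] in the size
    requirements. *)
Lemma tiling_cover (S : {set tup}) (l : seq ('I_k * 'I_n)) :
  tiling S -> (forall p, p \in l -> p.2 \in U p.1) ->
  (forall i x j, x \in U i -> j != i ->
     #|S| + size l + c <= #|[set y in U j | adj (i, x) (j, y)]|) ->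
  #|S| + size l + c <= m ->
  exists S' : {set tup}, [/\ S \subset S', tiling S', #|S'| <= #|S| + size l &
    forall p, p \in l -> p.2 \in covered p.1 S'].
Proof.
move=> tS; elim: l => [|[i x] l IH] hl hN hm /=; first by exists S; rewrite subxx addn0.
have [|||S1 [SS1 tS1 cS1 h1]] := IH.
- by move=> p pl; apply: hl; rewrite inE pl orbT.
- by move=> j y j' yU jj; apply: leq_trans (hN _ _ _ yU jj) => /=; lia.
- by apply: leq_trans hm => /=; lia.
have [|||S2 [SS2 tS2 cS2 h2]] := tiling_extend_at (i := i) (x := x) tS1.
- by apply: (hl (i, x)); rewrite inE eqxx.
- move=> j ji; have xU : x \in U i by apply: (hl (i, x)); rewrite inE eqxx.
  apply: leq_trans (hN _ _ _ xU ji) => /=; rewrite leq_add2r.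
  by apply: leq_trans cS1 _; rewrite leq_add2l.
- apply: leq_trans hm => /=; rewrite leq_add2r.
  by apply: leq_trans cS1 _; rewrite leq_add2l.
exists S2; split=> //; first exact: subset_trans SS2.
  by apply: leq_trans cS2 _; rewrite addnS ltnS.
move=> p; rewrite inE => /orP[/eqP->|/h1] //.
by apply/subsetP; apply: imsetS.
Qed.

(** A typical vertex can replace coordinate [i] in at least [L] members of [Q]; atypical ones have
    to be covered before absorption starts. *)
Definition atypical (Q : {set tup}) (i : 'I_k) (x : 'I_n) : bool :=
  #|[set f in Q | joins f i x]| < L.

(** Otherwise [s] atypical vertices are joined to at most [s * L] members of [Q] in all, and since
    [q] is [s * L.+1], the other members contradict [joinable]. *)
Lemma card_atypical (Q : {set tup}) (i : 'I_k) :
  pairwise_disjoint Q -> #|Q| = q -> #|[set x | atypical Q i x]| <= s.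
Proof.
move=> dQ cQ; rewrite leqNgt; apply/negP=> /ltnW /subset_of_card [A As cA].
pose B := \bigcup_(x in A) [set f in Q | joins f i x].
have cB : #|B| <= s * L.
  rewrite /B; apply: leq_trans (_ : \sum_(x in A) L <= _); last by rewrite sum_nat_const cA.
  apply: leq_trans (_ : \sum_(x in A) #|[set f in Q | joins f i x]| <= _).
    elim/big_rec2: _ => [|x N X _ h]; first by rewrite cards0.
    by rewrite cardsU; lia.
  by apply: leq_sum => x /(subsetP As); rewrite inE => /ltnW.
have [|Q' Q's cQ'] := @subset_of_card _ (Q :\: B) s.
  have := leq_trans (subset_leq_card (subsetIr Q B)) cB.
  by rewrite cardsD cQ mulnS; lia.
have [f [v [fQ vA fv]]] :=
  js i (pairwise_disjointS (subset_trans Q's (subsetDl _ _)) dQ) cQ' cA.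
have := subsetP Q's _ fQ; rewrite inE => /andP[/negP nB fQQ].
by apply: nB; apply/bigcupP; exists v => //; rewrite inE fQQ.
Qed.

(** Each [Q i] exchanges its vertex in class [i] for [v i], and the [k] released vertices form one
    further clique [w]. Thus [k] cliques become [k + 1] and no vertex is uncovered. *)
Lemma tiling_swap (S : {set tup}) (v : 'I_k -> 'I_n) (Q : 'I_k -> tup) :
  tiling S -> (forall i, v i \in U i :\: covered i S) ->
  (forall i, Q i \in S) -> injective Q -> (forall i, joins (Q i) i (v i)) ->
  transversal_clique [ffun i => Q i i] ->
  exists S' : {set tup}, [/\ tiling S', forall i, v i |: covered i S \subset covered i S' &
    S :\: [set Q i | i : 'I_k] \subset S'].
Proof.
move=> [dS hS] hv QS iQ jQ cw.
set w := finfun _ in cw; pose R i := upd (Q i) i (v i).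
pose S0 := S :\: [set Q i | i : 'I_k].
have vn i f : f \in S -> v i != f i.
  move=> fS; have := hv i; rewrite inE => /andP[/negP nf _].
  by apply/negP=> /eqP E; apply: nf; rewrite E; apply: imset_f.
have S0S f : f \in S0 -> f \in S /\ forall i, Q i != f.
  rewrite inE => /andP[/negP fQ ->]; split=> // i; apply/negP=> /eqP E; apply: fQ.
  by rewrite -E; apply: imset_f.
have QQ i j l : i != j -> Q i l != Q j l.
  by move=> ij; apply: dS => //; apply: contraNneq ij => /iQ ->.
have RR i j : i != j -> forall l, R i l != R j l.
  move=> ij l; rewrite !ffunE; case: (l =P i) => [li|/eqP li].
    by rewrite -li in ij *; rewrite (negbTE ij) vn.
  by case: (l =P j) => [->|_]; [rewrite eq_sym vn | rewrite QQ].
have Rw i l : R i l != w l.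
  rewrite !ffunE; case: (l =P i) => [->|/eqP li]; first exact: vn.
  by rewrite QQ // eq_sym.
have Rf i f l : f \in S0 -> R i l != f l.
  move=> /S0S[fS fQ]; rewrite ffunE; case: (l =P i) => [->|_]; first exact: vn.
  exact: dS.
have wf f l : f \in S0 -> w l != f l.
  by move=> /S0S[fS fQ]; rewrite ffunE; apply: dS.
exists (w |: ([set R i | i : 'I_k] :|: S0)); split; first split.
- move=> f g; rewrite !in_setU !in_set1.
  case/or3P=> [/eqP->|/imsetP[i _ ->]|fS0]; case/or3P=> [/eqP->|/imsetP[j _ ->]|gS0] fg l.
  + by rewrite eqxx in fg.
  + by rewrite eq_sym Rw.
  + exact: wf.
  + exact: Rw.
  + by apply: RR; apply: contraNneq fg => ->.
  + exact: Rf.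
  + by rewrite eq_sym wf.
  + by rewrite eq_sym Rf.
  + by apply: dS => //; [case/S0S: fS0 | case/S0S: gS0].
- move=> f; rewrite !in_setU !in_set1 => /or3P[/eqP->|/imsetP[i _ ->]|/S0S[/hS //]].
    by split=> // i; rewrite ffunE; case: (hS _ (QS i)).
  have [cQ QU] := hS _ (QS i); split; first exact: clique_upd.
  move=> j; rewrite ffunE; case: (j =P i) => [->|_] //.
  by have := hv i; rewrite inE => /andP[].
- move=> i; apply/subsetP=> x; rewrite in_setU1 => /orP[/eqP->|/imsetP[f fS ->]].
    apply/imsetP; exists (R i); last by rewrite ffunE eqxx.
    by rewrite !in_setU imset_f ?orbT.
  case: (boolP (f \in S0)) => [fS0|].
    by apply: imset_f; rewrite !in_setU fS0 !orbT.
  rewrite inE fS andbT negbK => /imsetP[j _ ->].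
  (* The vertex of [Q j] in class [i] is released into [w] if [i = j] and stays in [R j]
     otherwise. *)
  case: (i =P j) => [<-|/eqP ij].
    by apply/imsetP; exists w; rewrite ?setU11 // ffunE.
  apply/imsetP; exists (R j); last by rewrite ffunE (negbTE ij).
  by rewrite !in_setU imset_f ?orbT.
- by apply/subsetP=> f fS; rewrite !in_setU fS !orbT.
Qed.

Lemma tiling_le (S : {set tup}) : tiling S -> #|S| <= m.
Proof.
move=> [dS hS]; rewrite -(card_covered (Ordinal k_gt0) dS) -(cU (Ordinal k_gt0)).
by apply: subset_leq_card; apply/subsetP=> _ /imsetP[f /hS[_ hf] ->].
Qed.

(** The uncovered [v i] are typical, so each has [L] possible hosts in [Q], and at most half of [L]
    have left [S]. The remaining hosts suffice for disjoint families [G i] of size [c], whose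
    coordinates in class [i] contain the clique [w] to be released; disjointness makes the chosen
    hosts distinct. *)
Lemma tiling_augment (Q S : {set tup}) :
  tiling S -> #|S| < m ->
  (forall i x, x \in U i -> atypical Q i x -> x \in covered i S) ->
  #|Q :\: S| <= k * c ->
  exists S' : {set tup}, [/\ tiling S', #|S| < #|S'|, forall i, covered i S \subset covered i S' &
    #|Q :\: S'| <= #|Q :\: S| + k].
Proof.
move=> tS hm hA hQ; have [dS hS] := tS.
have nv i : exists v, v \in U i :\: covered i S.
  by apply/card_gt0P; apply: card_uncovered => //; rewrite cU; lia.
have nv' i : exists v, (v \in U i :\: covered i S) && true.
  by have [v hv] := nv i; exists v; rewrite hv.
pose v i := xchoose (nv' i).
have hv i : v i \in U i :\: covered i S.
  by have := xchooseP (nv' i); rewrite andbT.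
pose F i := [set f in Q | joins f i (v i)] :&: S.
have hF i : #|{: 'I_k}| * c <= #|F i|.
  rewrite card_ord; have h : L <= #|[set f in Q | joins f i (v i)]|.
    rewrite leqNgt; apply/negP=> h; have := hv i.
    by rewrite inE => /andP[/negP nS vU]; apply: nS; apply: hA.
  have h2 : #|[set f in Q | joins f i (v i)] :\: S| <= k * c.
    apply: leq_trans hQ; apply: subset_leq_card; apply: setSD.
    by apply/subsetP=> f; rewrite inE => /andP[].
  by have := cardsID S [set f in Q | joins f i (v i)]; rewrite /F; lia.
have [G [GF cG dG]] := disjoint_subsets hF.
have GS i f : f \in G i -> f \in S /\ joins f i (v i).
  by move/(subsetP (GF i)); rewrite !inE => /andP[/andP[_ ->] ->].
have [|w cw hw] := @exists_clique (fun i => covered i (G i)).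
  move=> i; rewrite card_covered ?cG // => f g /GS[fS _] /GS[gS _]; exact: dS.
have nR i : exists f, (f \in G i) && (w i == f i).
  by have /imsetP[f fG ->] := hw i; exists f; rewrite fG eqxx.
pose R i := xchoose (nR i).
have hR i : R i \in G i by have /andP[] := xchooseP (nR i).
have wR i : w i = R i i by have /andP[_ /eqP] := xchooseP (nR i).
have iR : injective R.
  move=> i j E; apply/eqP; apply: contraT => ij.
  by have := disjointFr (dG _ _ ij) (hR i); rewrite E hR.
have RS i := (GS _ _ (hR i)).1.
have wE : [ffun i => R i i] = w by apply/ffunP=> i; rewrite ffunE -wR.
have [||S' [tS' cS' SS']] := tiling_swap tS hv RS iR.
- by move=> i; have [] := GS _ _ (hR i).
- by rewrite wE.
exists S'; split=> //.
- have [dS' _] := tS'; pose i := Ordinal k_gt0.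
  rewrite -(card_covered i dS) -(card_covered i dS').
  apply: leq_trans (subset_leq_card (cS' i)); rewrite cardsU1.
  by have := hv i; rewrite inE => /andP[-> _].
- by move=> i; apply: subset_trans (cS' i); apply: subsetUr.
- have sub : Q :\: S' \subset (Q :\: S) :|: [set R i | i : 'I_k].
    apply/subsetP=> f; rewrite !in_setU !in_setD => /andP[fS' fQ]; rewrite fQ andbT.
    apply: contraR fS'; rewrite negb_or negbK => /andP[fS fR].
    by apply: (subsetP SS'); rewrite in_setD fR.
  apply: leq_trans (subset_leq_card sub) _; rewrite cardsU.
  have cR : #|[set R i | i : 'I_k]| <= k.
    by rewrite -[X in _ <= X]card_ord; apply: leq_imset_card.
  by apply: leq_trans (leq_subr _ _) _; rewrite leq_add2l.
Qed.

(** [t] bounds the number of cliques still missing. Each augmentation removes at most [k] members of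
    [Q], and [k * c] is the total loss that [tiling_augment] tolerates. *)
Lemma tiling_complete (Q S : {set tup}) (t : nat) :
  tiling S -> (forall i x, x \in U i -> atypical Q i x -> x \in covered i S) ->
  m <= #|S| + t -> #|Q :\: S| + k * t <= k * c ->
  exists2 S' : {set tup}, tiling S' & #|S'| = m.
Proof.
elim: t S => [|t IH] S tS hA ht hQ.
  by exists S => //; have := tiling_le tS; lia.
have [lt|ge] := ltnP #|S| m; last by exists S => //; have := tiling_le tS; lia.
have [|S' [tS' cS' sub hQ']] := tiling_augment tS lt hA; first by lia.
apply: (IH S') => //.
- by move=> i x xU /(hA _ _ xU); apply: subsetP.
- by lia.
- by move: hQ; rewrite mulnS; lia.
Qed.

(** In the bounds, [q] pays for the reserved family, [k * s] for covering the atypical vertices, at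
    most [s] per class, and [c] for finding a clique in what is left. *)
Lemma perfect_tiling :
  (forall i x j, x \in U i -> j != i ->
     q + k * s + c <= #|[set y in U j | adj (i, x) (j, y)]|) ->
  q + k * s + c <= m ->
  exists2 S : {set tup}, tiling S & #|S| = m.
Proof.
move=> hN hm.
have t0 : tiling set0 by split=> f; rewrite inE.
have [||Q [_ tQ cQ]] := tiling_grow (N := q) t0; rewrite ?cards0 //; first by lia.
pose P := [set p : 'I_k * 'I_n | (p.2 \in U p.1) && atypical Q p.1 p.2].
have cP : #|P| <= k * s.
  rewrite -sum1dep_card.
  rewrite -(pair_big_dep xpredT (fun i x => (x \in U i) && atypical Q i x) (fun _ _ => 1)) /=.
  rewrite -[k in k * s]card_ord -sum_nat_const; apply: leq_sum => i _.
  rewrite sum1dep_card; apply: leq_trans (card_atypical i tQ.1 cQ).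
  by apply: subset_leq_card; apply/subsetP=> x; rewrite !inE => /andP[].
have [|||S [QS tS cS hS]] := tiling_cover (l := enum P) tQ.
- by move=> p; rewrite mem_enum inE => /andP[].
- by move=> i x j xU ji; apply: leq_trans (hN _ _ _ xU ji); rewrite cQ -cardE; lia.
- by apply: leq_trans hm; rewrite cQ -cardE; lia.
have hA (S' : {set tup}) : S \subset S' ->
    forall i x, x \in U i -> atypical Q i x -> x \in covered i S'.
  move=> SS' i x xU xA; apply: (subsetP (imsetS _ SS')).
  by apply: (hS (i, x)); rewrite mem_enum inE xU.
(* Greedy extension is run until [c] vertices per class are uncovered; the last [c] cliques come
   from absorption, which starts with all of [Q] intact. *)
have [||S' [SS' tS' cS']] := tiling_grow (N := m - c) tS; [|by lia|].
  by move: cS; rewrite cQ -cardE; lia.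
apply: (@tiling_complete Q S' c) => //; first exact: hA.
  by lia.
by rewrite (_ : Q :\: S' = set0) ?cards0 //; apply/eqP; rewrite setD_eq0 (subset_trans QS).
Qed.

End Tiling.

(** * Rank functions and splitting by rank *)

(** The rank of [x] counts the vertices that reach [x] by arcs not in [H]. Along such an arc from
    [x] to [y] these vertices also reach [y], and [y] itself is new, since a path back to [x] would
    close a cycle. *)
Lemma fas_rank (T : finType) (e : rel T) (H : {set T * T}) :
  feedback_arc_set e H ->
  exists rk : T -> nat, forall x y, e x y -> rk y <= rk x -> (x, y) \in H.
Proof.
move=> [_ hH]; pose F := [rel x y | e x y && ((x, y) \notin H)].
exists (fun x => #|[set u | connect F u x]|) => x y exy; apply: contraTT => nH.
have Fxy : F x y by rewrite /= exy.
rewrite -ltnNge; apply: proper_card; apply/properP; split.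
  apply/subsetP=> u; rewrite !inE => /connect_trans; apply; exact: connect1.
exists y; rewrite inE ?connect0 //; apply/negP=> /connectP[p pp lp].
(* [directed_cycle] asks for distinct vertices, so the path is shortened before being closed up. *)
case: (shortenP pp) lp => p' pp' up' _ lp.
have cyc : cycle F (y :: p') by rewrite /= rcons_path pp' -lp.
move: (hH (y :: p')); rewrite /directed_cycle up' /=.
have sub1 : subrel F e by move=> a b /andP[].
have sub2 : subrel F (fun x y => (x, y) \notin H) by move=> a b /andP[].
have := sub_path sub1 cyc; have := sub_path sub2 cyc; rewrite /= => -> -> h.
by have := h isT.
Qed.

(** Let [mu] be least such that [r] elements of [T] have [psi] at most [mu]; by minimality [r]
    elements have [psi] at least [mu]. A side of [mu] holding [r] elements of [S] is paired with the
    opposite side of [T]. *)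
Lemma halving (A B : finType) (phi : A -> nat) (psi : B -> nat)
    (S : {set A}) (T : {set B}) (r : nat) :
  2 * r <= #|S| -> 2 * r <= #|T| ->
  exists (S' : {set A}) (T' : {set B}), [/\ S' \subset S, T' \subset T,
    r <= #|S'|, r <= #|T'| &
    (forall a b, a \in S' -> b \in T' -> psi b <= phi a) \/
    (forall a b, a \in S' -> b \in T' -> phi a <= psi b)].
Proof.
move=> hS hT.
have exm : exists mu, r <= #|[set b in T | psi b <= mu]|.
  exists (\max_(b : B) psi b); rewrite (_ : [set b in T | _] = T); first by lia.
  by apply/setP=> b; rewrite inE leq_bigmax andbT.
case: (ex_minnP exm) => mu hmu minmu.
have hi : r <= #|[set b in T | mu <= psi b]|.
  (* For [mu = 0] there is no smaller value to compare with, but every [psi b] is at least [0]. *)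
  case: mu hmu minmu => [|mu] hmu minmu.
    rewrite (_ : [set b in T | _] = T); first by lia.
    by apply/setP=> b; rewrite inE andbT.
  have h : #|[set b in T | psi b <= mu]| < r.
    by rewrite ltnNge; apply/negP=> /minmu; rewrite ltnn.
  have := cardsID [set b | psi b <= mu] T.
  have -> : T :&: [set b | psi b <= mu] = [set b in T | psi b <= mu].
    by apply/setP=> b; rewrite !inE.
  have -> : T :\: [set b | psi b <= mu] = [set b in T | mu < psi b].
    by apply/setP=> b; rewrite !inE -ltnNge andbC.
  by lia.
have := cardsID [set a | mu <= phi a] S.
have [h _|h hc] := leqP r #|S :&: [set a | mu <= phi a]|.
  exists (S :&: [set a | mu <= phi a]), [set b in T | psi b <= mu]; split=> //.
  - exact: subsetIl.
  - by apply/subsetP=> b; rewrite inE => /andP[].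
  - left=> a b; rewrite !inE => /andP[_ h1] /andP[_ h2]; exact: leq_trans h1.
exists (S :\: [set a | mu <= phi a]), [set b in T | mu <= psi b]; split=> //.
- exact: subsetDl.
- by apply/subsetP=> b; rewrite inE => /andP[].
- by lia.
- right=> a b; rewrite !inE -ltnNge => /andP[h1 _] /andP[_ h2].
  exact: leq_trans (ltnW h1) h2.
Qed.

Lemma halving_seq (I : eqType) (A B : finType) (phi : I -> A -> nat) (psi : B -> nat)
    (l : seq I) (S : {set A}) (T : {set B}) (r : nat) :
  2 ^ size l * r <= #|S| -> 2 ^ size l * r <= #|T| ->
  exists (S' : {set A}) (T' : {set B}), [/\ S' \subset S, T' \subset T,
    r <= #|S'|, r <= #|T'| & forall i, i \in l ->
    (forall a b, a \in S' -> b \in T' -> psi b <= phi i a) \/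
    (forall a b, a \in S' -> b \in T' -> phi i a <= psi b)].
Proof.
elim: l S T => [|i l IH] S T /=.
  by rewrite expn0 mul1n => hS hT; exists S, T.
rewrite expnS -mulnA => hS hT.
have [S1 [T1 [SS TT hS1 hT1 h1]]] := halving (phi i) psi hS hT.
have [S2 [T2 [SS2 TT2 hS2 hT2 h2]]] := IH _ _ hS1 hT1.
exists S2, T2; split=> //; try by [apply: subset_trans SS|apply: subset_trans TT].
move=> j; rewrite inE => /orP[/eqP->|/h2 //].
by case: h1 => h; [left|right] => a b /(subsetP SS2) aS /(subsetP TT2) bT; apply: h.
Qed.

(** * The bad events and their probabilities *)

Section Events.

Variables (k n : nat).
Local Notation tup := {ffun 'I_k -> 'I_n}.

(** Disjointness and injectivity constrain only the index; inside the event they make it empty for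
    other indices, so a union bound may range over all functions. *)
Definition star_avoid (r : nat) (j : 'I_k) (d : {ffun 'I_k -> bool})
    (S : {ffun 'I_r -> tup}) (T : {ffun 'I_r -> 'I_n}) : {set orientation k n} :=
  [set o | [&& [forall a, forall b, (a != b) ==> [forall i, S a i != S b i]],
    injectiveb T &
    [forall a, forall b, exists i, (i != j) && (arc o (i, S a i) (j, T b) != d i)]]].

(** Class [j] is cut into intervals of length [r]. With one event per interval, avoiding all of them
    gives a middle vertex in each, hence many distinct ones. *)
Definition block_avoid (r : nat) (j : 'I_k) (u v : vtx k n) (t : nat) :
    {set orientation k n} :=
  [set o | [&& u != v, u.1 != j, v.1 != j &
    [forall x : 'I_n, (x %/ r == t) ==> ~~ (arc o u (j, x) && arc o (j, x) v)]]].

(** The [r * r] stars are edge-disjoint: those with a common centre come from different, hence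
    disjoint, transversals. *)
Lemma card_star_avoid (r : nat) (j : 'I_k) (d : {ffun 'I_k -> bool})
    (S : {ffun 'I_r -> tup}) (T : {ffun 'I_r -> 'I_n}) :
  #|star_avoid j d S T| * (2 ^ k) ^ (r * r)
    <= (2 ^ k - 1) ^ (r * r) * #|{: orientation k n}|.
Proof.
case: (boolP [forall a, forall b, (a != b) ==> [forall i, S a i != S b i]]) => hS; last first.
  by rewrite (_ : star_avoid _ _ _ _ = set0) ?cards0 //; apply/setP=> o; rewrite !inE (negbTE hS).
case: (boolP (injectiveb T)) => hT; last first.
  by rewrite (_ : star_avoid _ _ _ _ = set0) ?cards0 //;
    apply/setP=> o; rewrite !inE (negbTE hT) andbF.
pose Y (p : 'I_r * 'I_r) : {set vtx k n} := [set (i, S p.1 i) | i in [set i | i != j]].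
have := @card_avoid_stars k n k ('I_r * 'I_r)%type j (fun p => T p.2) Y (fun y => d y.1).
rewrite card_prod card_ord => /(_ _ _ _) h.
apply: leq_trans (h _ _ _).
- rewrite leq_mul2r; apply/orP; right; apply: subset_leq_card.
  apply/subsetP=> o; rewrite !inE => /and3P[_ _ /forallP ho].
  apply/forallP=> -[a b] /=; have /forallP/(_ b)/existsP[i /andP[ij hi]] := ho a.
  apply/existsP; exists (i, S a i); rewrite hi andbT.
  by apply/imsetP; exists i; rewrite ?inE.
- move=> p; apply: leq_trans (leq_imset_card _ _) _.
  by rewrite -[X in _ <= X]card_ord max_card.
- by move=> p y /imsetP[i]; rewrite inE => ij ->.
- move=> [a b] [a' b'] /= ab /(injectiveP _ hT) E.
  have aa : a != a' by apply: contraNneq ab => ->; rewrite E.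
  rewrite -setI_eq0; apply/eqP/setP=> y; rewrite !inE.
  apply/negP=> /andP[/imsetP[i _ ->] /imsetP[i' _ [ii]]]; rewrite -ii => /eqP.
  by have /forallP/(_ a')/implyP/(_ aa)/forallP/(_ i)/negbTE-> := forallP hS a.
Qed.

(** Each [x] in the block is the centre of a star with the two leaves [u] and [v], and [2 <= k] lets
    it share the rate of the larger stars. The bound on [n] makes the block complete. *)
Lemma card_block_avoid (r : nat) (j : 'I_k) (u v : vtx k n) (t : nat) :
  2 <= k -> t.+1 * r <= n ->
  #|block_avoid r j u v t| * (2 ^ k) ^ r <= (2 ^ k - 1) ^ r * #|{: orientation k n}|.
Proof.
move=> hk hn.
case: (boolP (u != v)) => uv; last first.
  by rewrite (_ : block_avoid _ _ _ _ _ = set0) ?cards0 //;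
    apply/setP=> o; rewrite !inE (negbTE uv).
case: (boolP (u.1 != j)) => uj; last first.
  by rewrite (_ : block_avoid _ _ _ _ _ = set0) ?cards0 //;
    apply/setP=> o; rewrite !inE (negbTE uj) andbF.
case: (boolP (v.1 != j)) => vj; last first.
  by rewrite (_ : block_avoid _ _ _ _ _ = set0) ?cards0 //;
    apply/setP=> o; rewrite !inE (negbTE vj) !andbF.
have hw (b : 'I_r) : t * r + b < n.
  by apply: leq_trans hn; rewrite mulSn addnC ltn_add2r.
pose w b := Ordinal (hw b).
have := @card_avoid_stars k n k 'I_r j w (fun=> [set u; v]) (fun y => y == u).
rewrite card_ord => h; apply: leq_trans (h _ _ _).
- rewrite leq_mul2r; apply/orP; right; apply: subset_leq_card.
  apply/subsetP=> o; rewrite !inE => /and4P[_ _ _ /forallP ho].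
  apply/forallP=> b; have := ho (w b).
  have -> : w b %/ r == t.
    by rewrite /= divnMDl ?divn_small ?addn0 //; apply: leq_ltn_trans (ltn_ord b).
  rewrite (arcC o (u := v) (v := (j, w b)) vj) negb_and negbK /= => /orP[hu|hv]; apply/existsP.
    by exists u; rewrite set21 eqxx (negbTE hu).
  by exists v; rewrite set22 hv [v == u]eq_sym (negbTE uv).
- by move=> _; rewrite cards2 uv.
- by move=> _ y; rewrite !inE => /orP[/eqP->|/eqP->].
- by move=> a b ab /(congr1 val) /= /addnI E; rewrite (val_inj E) eqxx in ab.
Qed.

End Events.

(** * From the absence of bad events to disjoint cliques *)

Section Deterministic.

Variables (k n r : nat) (o : orientation k n).
Local Notation tup := {ffun 'I_k -> 'I_n}.
Local Notation s := (2 ^ k * r).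
Local Notation c := (k.+1 * s).
(** [D] is the degree that [perfect_tiling] requires, and the extra [k] allows for deleted vertices.
    Two vertices of degree below [D + k] have fewer than [M] neighbours together. *)
Local Notation D := (s * (2 * (k * c)).+1 + k * s + c).
Local Notation M := (2 * (D + k)).

Variable H : {set vtx k n * vtx k n}.
Variable rk : vtx k n -> nat.
Hypothesis hrk : forall x y, arc o x y -> rk y <= rk x -> (x, y) \in H.

Lemma joinable_of_stars :
  (forall j d S T, o \notin @star_avoid k n r j d S T) -> joinable (adjH H) s.
Proof.
move=> ho j S T dS cS cT.
have hS : 2 ^ size (enum 'I_k) * r <= #|S| by rewrite size_enum_ord cS.
have hT : 2 ^ size (enum 'I_k) * r <= #|T| by rewrite size_enum_ord cT.
have [S1 [T1 [SS TT hS1 hT1 h]]] :=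
  halving_seq (fun i (f : tup) => rk (i, f i)) (fun v => rk (j, v)) hS hT.
(* [d i] records how the ranks in coordinate [i] compare with those in class [j], and so which
   orientation of the edge is backward and must lie in [H]. *)
pose d := [ffun i : 'I_k => [forall f in S1, forall v in T1, rk (j, v) <= rk (i, f i)]].
pose F := [ffun a : 'I_r => enum_val (widen_ord hS1 a)].
pose G := [ffun a : 'I_r => enum_val (widen_ord hT1 a)].
have FS a : F a \in S1 by rewrite ffunE enum_valP.
have GT a : G a \in T1 by rewrite ffunE enum_valP.
have := ho j d F G; rewrite inE => /and3P hh.
case: (boolP [exists a, exists b, forall i, (i != j) ==> (arc o (i, F a i) (j, G b) == d i)]).
  case/existsP=> a /existsP[b /forallP hab]; exists (F a), (G b); split.
  - exact: (subsetP SS).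
  - exact: (subsetP TT).
  apply/joinsP=> i ij; have := hab i; rewrite ij /= => /eqP hd.
  rewrite /adjH; case E: (d i) hd => hd.
    apply/orP; left; apply: hrk => //; move: E; rewrite ffunE.
    by move/forall_inP/(_ _ (FS a))/forall_inP/(_ _ (GT b)).
  apply/orP; right; apply: hrk; first by rewrite (arcC o (u := (i, F a i))) //= hd.
  case: (h i (mem_enum _ _)) => hi; last exact: hi.
  move: E; rewrite ffunE; case/negP; apply/forall_inP=> f fS; apply/forall_inP=> v vT.
  exact: hi.
(* If no star follows [d], then [F] and [G] witness an excluded event. *)
move=> hn; case: hh; split.
- apply/forallP=> a; apply/forallP=> b; apply/implyP=> ab; apply/forallP=> i.
  apply: dS; rewrite ?(subsetP SS) //; apply: contraNneq ab; rewrite !ffunE.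
  by move=> /enum_val_inj/(congr1 val) /= E; apply/eqP/val_inj.
- apply/injectiveP=> a b; rewrite !ffunE => /enum_val_inj/(congr1 val) /= E.
  exact: val_inj.
- apply/forallP=> a; apply/forallP=> b; apply: contraR hn => nn.
  apply/existsP; exists a; apply/existsP; exists b; apply/forallP=> i; apply/implyP=> ij.
  by apply: contraR nn => hd; apply/existsP; exists i; rewrite ij.
Qed.

Definition low_degree (j : 'I_k) : {set vtx k n} :=
  [set v : vtx k n | (v.1 != j) && (#|[set y | adjH H v (j, y)]| < D + k)].

(** The blocks give [M] distinct [x] with arcs from [u] to [x] and from [x] to [v]. Fewer than [M]
    of them are [H]-adjacent to [u] or [v]; for another [x] neither arc is in [H], so both increase
    the rank. *)
Lemma low_degree_rank (j : 'I_k) (u v : vtx k n) :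
  (forall t : 'I_M, o \notin @block_avoid k n r j u v t) -> u != v ->
  u \in low_degree j -> v \in low_degree j -> rk u < rk v.
Proof.
move=> ho uv; rewrite !inE => /andP[uj hu] /andP[vj hv].
have ex (t : 'I_M) : exists x : 'I_n, [&& x %/ r == t, arc o u (j, x) & arc o (j, x) v].
  have := ho t; rewrite inE uv uj vj /= negb_forall => /existsP[x].
  by rewrite negb_imply negbK => hx; exists x.
have [x hx] := fin_all_exists ex.
have xi : injective x.
  move=> a b E; apply: val_inj; have /and3P[/eqP ea _ _] := hx a.
  by have /and3P[/eqP eb _ _] := hx b; rewrite /= -ea -eb E.
have bound w : #|[set y | adjH H w (j, y)]| < D + k ->
    #|[set t | adjH H w (j, x t)]| < D + k.
  apply: leq_ltn_trans; rewrite -(card_imset _ xi); apply: subset_leq_card.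
  by apply/subsetP=> _ /imsetP[t ht ->]; rewrite !inE in ht *.
have /card_gt0P[t] : 0 < #|~: ([set t | adjH H u (j, x t)] :|: [set t | adjH H v (j, x t)])|.
  have := cardsC ([set t | adjH H u (j, x t)] :|: [set t | adjH H v (j, x t)]).
  have := (leq_card_setU [set t | adjH H u (j, x t)] [set t | adjH H v (j, x t)]).1.
  by rewrite card_ord; have := bound u hu; have := bound v hv; lia.
rewrite !inE negb_or /adjH !negb_or => /andP[/andP[hu' _] /andP[_ hv']].
have /and3P[_ a1 a2] := hx t.
apply: (@ltn_trans (rk (j, x t))); rewrite ltnNge.
  by apply: contraNN hu' => /(hrk a1).
by apply: contraNN hv' => /(hrk a2).
Qed.

Lemma card_low_degree (j : 'I_k) :
  (forall u v (t : 'I_M), o \notin @block_avoid k n r j u v t) ->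
  #|low_degree j| <= 1.
Proof.
move=> ho; apply/card_le1P=> u hu v; have -> : (v \in pred1 u) = (v == u) by []; apply/idP/eqP=> [hv|-> //].
apply/eqP; apply: contraT => vu.
have h1 := low_degree_rank (ho v u) vu hv hu.
have h2 := low_degree_rank (ho u v) _ hu hv.
by have := ltn_trans h1 (h2 _); rewrite ltnn eq_sym vu => /(_ isT).
Qed.

Lemma cliques_of_events :
  0 < k -> 0 < r -> D + k <= n ->
  (forall j d S T, o \notin @star_avoid k n r j d S T) ->
  (forall j u v (t : 'I_M), o \notin @block_avoid k n r j u v t) ->
  has_disjoint_cliques H k (n - k + 1).
Proof.
move=> k0 r0 hn hstar hblock.
have s0 : 0 < s by rewrite muln_gt0 expn_gt0 r0.
(* Each class [j] other than [i] contributes at most one vertex to [B i], so a set of [n - k + 1]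
   vertices avoiding [B i] exists. *)
pose B i := [set x | [exists j, (j != i) && ((i, x) \in low_degree j)]].
have cB i : #|B i| <= k.-1.
  have sub : B i \subset \bigcup_(j | j != i) [set x | (i, x) \in low_degree j].
    apply/subsetP=> x; rewrite inE => /existsP[j /andP[ji hx]].
    by apply/bigcupP; exists j; rewrite ?in_set1 // in_set.
  apply: leq_trans (subset_leq_card sub) _.
  apply: leq_trans (_ : \sum_(j | j != i) 1 <= _); last first.
    by rewrite sum1_card cardC1 card_ord.
  apply: leq_trans (_ : \sum_(j | j != i) #|[set x | (i, x) \in low_degree j]| <= _).
    elim/big_rec2: _ => [|j N X _ h]; first by rewrite cards0.
    by apply: leq_trans (leq_card_setU _ _).1 _; rewrite leq_add2l.
  apply: leq_sum => j _; apply: leq_trans (card_low_degree (hblock j)).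
  have inj : injective (fun x : 'I_n => (i, x)) by move=> x y [].
  rewrite -(card_imset _ inj); apply: subset_leq_card.
  by apply/subsetP=> _ /imsetP[x hx ->]; rewrite inE in hx.
have exU i : exists U : {set 'I_n}, U \subset ~: B i /\ #|U| = n - k + 1.
  have [|U US cU] := @subset_of_card _ (~: B i) (n - k + 1); last by exists U.
  by have := cardsC (B i); rewrite card_ord; have := cB i; lia.
have [U hU] := fin_all_exists exU.
have cU i : #|U i| = n - k + 1 by case: (hU i).
have adjC : symmetric (adjH H) by move=> x y; rewrite /adjH orbC.
have [||S [dS hS] cS] := perfect_tiling adjC k0 s0 (joinable_of_stars hstar) cU.
- move=> i x j xU ji.
  have xB : x \notin B i by have := subsetP (hU i).1 _ xU; rewrite inE.
  (* Fewer than [k] vertices of class [j] lie outside [U j], so [D] of these neighbours survive in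
     [U j]. *)
  have deg : D + k <= #|[set y | adjH H (i, x) (j, y)]|.
    rewrite leqNgt; apply: contraNN xB => h; rewrite inE; apply/existsP; exists j.
    by rewrite ji inE /= eq_sym ji.
  have := cardsID (U j) [set y | adjH H (i, x) (j, y)].
  have -> : [set y | adjH H (i, x) (j, y)] :&: U j = [set y in U j | adjH H (i, x) (j, y)].
    by apply/setP=> y; rewrite !inE andbC.
  have h1 : #|[set y | adjH H (i, x) (j, y)] :\: U j| <= k.
    have h2 : #|[set y | adjH H (i, x) (j, y)] :\: U j| <= #|~: U j|.
      by apply: subset_leq_card; rewrite setDE subsetIr.
    by have := cardsC (U j); rewrite card_ord cU; lia.
  move=> e; rewrite -(leq_add2r k); apply: leq_trans deg _.
  by rewrite -e leq_add2l.
- by lia.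
pose f (a : 'I_(n - k + 1)) := enum_val (cast_ord (esym cS) a).
have fS a : f a \in S by apply: enum_valP.
exists (fun a => [set (i, f a i) | i : 'I_k]); split=> [a|a b ab].
  split; first by rewrite card_imset ?card_ord // => i j [].
  move=> _ _ /imsetP[i _ ->] /imsetP[j _ ->] ij.
  have [cf _] := hS _ (fS a); apply: cf.
  by apply: contraNneq ij => ->.
rewrite -setI_eq0; apply/eqP/setP=> x; rewrite !inE.
apply/negP=> /andP[/imsetP[i _ ->] /imsetP[i' _ [ii]]]; rewrite -ii => /eqP.
apply/negP; apply: dS => //; apply: contraNneq ab => /enum_val_inj/cast_ord_inj ->.
exact: eqxx.
Qed.

End Deterministic.

(** * Union bounds over the bad events *)

Lemma card_bigcup_mul (X T : finType) (F : X -> {set T}) (a b : nat) :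
  (forall x, #|F x| * a <= b) -> #|\bigcup_x F x| * a <= #|X| * b.
Proof.
move=> h; apply: leq_trans (_ : (\sum_x #|F x|) * a <= _).
  rewrite leq_mul2r; apply/orP; right.
  elim/big_rec2: _ => [|x N Y _ hN]; first by rewrite cards0.
  by apply: leq_trans (leq_card_setU _ _).1 _; rewrite leq_add2l.
by rewrite big_distrl /= -sum_nat_const; apply: leq_sum.
Qed.

Section Events.

Variables (k n r M : nat).

Definition star_events : {set orientation k n} :=
  \bigcup_(x : 'I_k * {ffun 'I_k -> bool} * {ffun 'I_r -> {ffun 'I_k -> 'I_n}}
               * {ffun 'I_r -> 'I_n}) star_avoid x.1.1.1 x.1.1.2 x.1.2 x.2.

Definition block_events : {set orientation k n} :=
  \bigcup_(x : 'I_k * vtx k n * vtx k n * 'I_M) block_avoid r x.1.1.1 x.1.1.2 x.1.2 x.2.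

(** The number of indices has an exponent linear in [r], against the [r * r] stars in each event. *)
Lemma card_star_events :
  #|star_events| * (2 ^ k) ^ (r * r) <=
  k * 2 ^ k * (n ^ k.+1) ^ r * ((2 ^ k - 1) ^ (r * r) * #|{: orientation k n}|).
Proof.
apply: leq_trans (card_bigcup_mul (fun x => card_star_avoid _ _ _ _)) _.
rewrite !card_prod !card_ffun !card_ord card_bool.
by rewrite (expnSr n) expnMn !mulnA.
Qed.

Lemma card_block_events : 2 <= k -> M * r <= n ->
  #|block_events| * (2 ^ k) ^ r <=
  k * (k * n) * (k * n) * M * ((2 ^ k - 1) ^ r * #|{: orientation k n}|).
Proof.
move=> hk hM; apply: leq_trans (card_bigcup_mul (fun x => card_block_avoid _ _ _ hk _)) _.
  by move=> x; apply: leq_trans hM; rewrite leq_mul2r ltn_ord orbT.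
by rewrite !card_prod !card_ord.
Qed.

End Events.

(** * Geometric decay against polynomial growth *)

Section Decay.
Local Open Scope ring_scope.
Variable rho : rat.
Hypotheses (rho0 : 0 <= rho) (rho1 : rho < 1).

(** The right side is [1 - rho] times the sum of [rho ^+ i] over [i < t], and each of these [t]
    terms is at least [rho ^+ t]. *)
Lemma linear_geometric_le1 (t : nat) : (1 - rho) * t%:R * rho ^+ t <= 1 - rho ^+ t.
Proof.
elim: t => [|t IH]; first by rewrite expr0 mulr0 mul0r subrr.
have h : 0 <= (1 - rho) * (1 - rho ^+ t.+1).
  by rewrite mulr_ge0 ?subr_ge0 ?exprn_ile1 // ltW.
have h2 := ler_wpM2l rho0 IH.
rewrite -natr1; rewrite exprS in h *; nra.
Qed.

(** With [t] about [r / (p + 1)], the decay contains [p + 1] factors [rho ^+ t], each at most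
    [B / t]. Only [p] of the factors [1 / t] are spent on [r%:R ^+ p], so the product is
    [O(1 / t)]. *)
Lemma polynomial_geometric_small (p : nat) (C eps : rat) : 0 <= C -> 0 < eps ->
  exists r0 : nat, forall r : nat, (r0 <= r)%N -> C * r%:R ^+ p * rho ^+ r <= eps.
Proof.
move=> C0 eps0; pose P := p.+1; pose B := (1 - rho)^-1.
have B0 : 0 <= B by rewrite invr_ge0 subr_ge0 ltW.
pose K := C * (2 * P)%:R ^+ p * B ^+ P.
have K0 : 0 <= K by rewrite !mulr_ge0 ?exprn_ge0.
pose t0 := (Num.bound (K / eps)).+1.
exists (P * t0)%N => r hr; pose t := (r %/ P)%N.
have t0t : (t0 <= t)%N by rewrite leq_divRL // mulnC.
have tpos : 0 < t%:R :> rat by rewrite ltr0n; apply: leq_trans t0t.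
have Kt : K <= eps * t%:R.
  have := archi_boundP (divr_ge0 K0 (ltW eps0)).
  rewrite ltr_pdivrMr // [eps * _]mulrC => /ltW /le_trans; apply.
  by rewrite ler_pM2r // ler_nat; apply: leq_trans t0t.
have tB : t%:R * rho ^+ t <= B.
  rewrite /B -div1r ler_pdivlMr ?subr_gt0 // mulrC mulrA.
  apply: le_trans (linear_geometric_le1 t) _.
  by rewrite lerBlDr lerDl exprn_ge0.
have rle : r%:R <= (2 * P)%:R * t%:R :> rat.
  have tp : (0 < t)%N by apply: leq_trans t0t.
  rewrite -natrM ler_nat [r in (r <= _)%N](divn_eq r P) -/t mul2n -addnn mulnDl mulnC.
  by rewrite leq_add2l ltnW // (leq_trans (ltn_pmod r _)) // leq_pmulr.
have rhole : rho ^+ r <= (rho ^+ t) ^+ P.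
  by rewrite -exprM ler_wiXn2l // ?(ltW rho1) // leq_trunc_div.
(* Multiplying by [t] turns its power [p] into [P], matching the [P] factors [rho ^+ t]. *)
rewrite -(ler_pM2r tpos); apply: le_trans Kt.
have h1 : r%:R ^+ p <= ((2 * P)%:R * t%:R) ^+ p :> rat by rewrite lerXn2r // ?nnegrE -?natrM ?ler0n.
have h2 : (t%:R * rho ^+ t) ^+ P <= B ^+ P.
  by rewrite lerXn2r ?nnegrE // mulr_ge0 ?exprn_ge0 // ltW.
apply: le_trans (_ : C * ((2 * P)%:R * t%:R) ^+ p * (rho ^+ t) ^+ P * t%:R <= _).
  rewrite ler_pM2r //; apply: ler_pM; rewrite ?mulr_ge0 ?exprn_ge0 //.
  exact: ler_wpM2l.
have -> : C * ((2 * P)%:R * t%:R) ^+ p * (rho ^+ t) ^+ P * t%:R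
    = C * (2 * P)%:R ^+ p * (t%:R * rho ^+ t) ^+ P.
  by rewrite !exprMn [t%:R ^+ P]exprS; ring.
by apply: ler_wpM2l => //; rewrite mulr_ge0 // exprn_ge0.
Qed.

End Decay.

(** * Choice of parameters and passage to the limit *)

(** Here [d] is the threshold [D + k] of the deterministic part. *)
Lemma good_of_events (k n r M : nat) (o : orientation k n) :
  let s := (2 ^ k * r)%N in
  let d := (s * (2 * (k * (k.+1 * s))).+1 + k * s + k.+1 * s + k)%N in
  0 < k -> 0 < r -> M = (2 * d)%N -> d <= n ->
  o \notin star_events k n r -> o \notin block_events k n r M -> good_tournament o.
Proof.
move=> s d k0 r0 eM hd hs hb H [fasH _]; have [rk hrk] := fas_rank fasH.
rewrite eM in hb; apply: (cliques_of_events (r := r) hrk) => //.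
- move=> j e S T; apply: contraNN hs => h; apply/bigcupP.
  by exists (j, e, S, T).
- move=> j u v t; apply: contraNN hb => h; apply/bigcupP.
  by exists (j, u, v, t).
Qed.

(** Why a fourth root: [2 * d] blocks of length [r], with [d] quadratic in [r], need a class of size
    cubic in [r]; one more factor [r] absorbs the constants. *)
Lemma fourth_root (n : nat) : exists2 r, r ^ 4 <= n & n < r.+1 ^ 4.
Proof.
elim: n => [|n [r h1 h2]]; first by exists 0.
have [h|h] := ltnP n.+1 (r.+1 ^ 4); first by exists r => //; apply: leqW.
exists r.+1 => //; apply: leq_ltn_trans h2 _.
by rewrite ltn_exp2r.
Qed.

Local Open Scope ring_scope.

Lemma ratio_of_count (a N p e tot : nat) : (0 < p)%N ->
  (a * p ^ e <= N * ((p - 1) ^ e * tot))%N ->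
  a%:R <= N%:R * ((p - 1)%:R / p%:R) ^+ e * tot%:R :> rat.
Proof.
move=> p0; rewrite -(ler_nat rat) !natrM !natrX => h.
have pp : 0 < (p%:R : rat) ^+ e by rewrite exprn_gt0 // ltr0n.
rewrite expr_div_n -(ler_pM2r pp); apply: le_trans h _.
by rewrite le_eqVlt; apply/orP; left; apply/eqP; field; rewrite lt0r_neq0.
Qed.

Lemma le_of_halves (x y z t e : rat) :
  t <= x + y + z -> x <= e / 2 * t -> y <= e / 2 * t -> (1 - e) * t <= z.
Proof. by lra. Qed.

(* a.a.s.: P(T in R(n,k) is good) -> 1 as n -> oo, with k >= 2 fixed. *)
Theorem theorem2p1 (k : nat) (hk : (2 <= k)%N) :
  forall eps : rat, (0 < eps)%R ->
  exists N : nat, forall n : nat, (N <= n)%N ->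
    (1 - eps <= prob_R (@good_tournament k n))%R.
Proof.
move=> eps eps0; have k0 : (0 < k)%N by apply: ltnW.
pose rho : rat := (2 ^ k - 1)%:R / (2 ^ k)%:R.
have p0 : (0 < 2 ^ k)%N by rewrite expn_gt0.
have p0' : 0 < (2 ^ k)%:R :> rat by rewrite ltr0n.
have rho0 : 0 <= rho by rewrite divr_ge0.
have rho1 : rho < 1 by rewrite /rho ltr_pdivrMr // mul1r ltr_nat ltn_subrL p0.
pose w := (k * 2 ^ k)%N.
have w0 : 0 < w%:R :> rat by rewrite ltr0n muln_gt0 k0.
(* The cap [1] gives [y ^+ r <= y] for the quantity [y] bounded below; the other term then absorbs
   the factor [w]. *)
pose delta := Num.min 1 (eps / 2 / w%:R).
have delta0 : 0 < delta by rewrite lt_min ltr01 !divr_gt0.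
(* [b] is kept opaque so that its powers are not computed. *)
have [b be] : exists b, b = 16%N by exists 16%N.
have [r1 h1] := polynomial_geometric_small rho0 rho1 (4 * k.+1) (ler0n _ (b ^ k.+1)) delta0.
have [r2 h2] := polynomial_geometric_small rho0 rho1 (4 * 3) (ler0n _ (k ^ 3 * b ^ 3))
  (divr_gt0 eps0 (ltr0n _ 2)).
pose A := (2 ^ k * (2 * (k * (k.+1 * 2 ^ k))).+1 + k * 2 ^ k + k.+1 * 2 ^ k + k)%N.
(* [r1] and [r2] make the two kinds of events rare, and [2 * A] ensures [2 * A * r ^ 3 <= r ^ 4], so
   that the blocks fit. *)
pose R0 := (r1 + r2 + 2 * A).+1.
exists (R0 ^ 4)%N => n hn; have [r rn nr] := fourth_root n.
have hR : (R0 <= r)%N.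
  by have := leq_ltn_trans hn nr; rewrite ltn_exp2r // ltnS.
have hr1 : (r1 <= r)%N by apply: leq_trans hR; rewrite /R0 -addnA -addnS leq_addr.
have hr2 : (r2 <= r)%N.
  by apply: leq_trans hR; rewrite /R0 (addnC r1) -addnA -addnS leq_addr.
have r0 : (0 < r)%N by apply: leq_trans hR.
pose s := (2 ^ k * r)%N.
pose d := (s * (2 * (k * (k.+1 * s))).+1 + k * s + k.+1 * s + k)%N.
have dA : (d <= A * r ^ 2)%N.
  rewrite /d /A /s; move: (2 ^ k)%N => p.
  have -> : (p * r * (2 * (k * (k.+1 * (p * r)))).+1 + k * (p * r) + k.+1 * (p * r) + k
      = p * (2 * (k * (k.+1 * p))) * r ^ 2 + (p + k * p + k.+1 * p) * r + k * 1)%N by ring.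
  have -> : (p * (2 * (k * (k.+1 * p))).+1 + k * p + k.+1 * p + k
      = p * (2 * (k * (k.+1 * p))) + (p + k * p + k.+1 * p) + k)%N by ring.
  have rr : (r <= r ^ 2)%N by rewrite -[X in (X <= _)%N]expn1 leq_pexp2l.
  by rewrite !mulnDl !leq_add ?leq_mul // (leq_trans r0).
have dr : (2 * d * r <= n)%N.
  apply: leq_trans rn; have h : (2 * A <= r)%N by apply: leq_trans hR; rewrite /R0 leqW ?leq_addl.
  apply: leq_trans (_ : 2 * (A * r ^ 2) * r <= _)%N.
    by rewrite leq_mul2r leq_mul2l dA !orbT.
  have -> : (2 * (A * r ^ 2) * r = 2 * A * r ^ 3)%N by ring.
  by rewrite (expnS r 3) leq_mul2r h orbT.
have dn : (2 * d <= n)%N by apply: leq_trans dr; rewrite leq_pmulr.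
(* Since [r] is positive, [r.+1] is at most [2 * r], whence the constant [16]. *)
have n16 : (n <= b * r ^ 4)%N.
  rewrite be (_ : 16 = 2 ^ 4)%N // -expnMn; apply: leq_trans (ltnW nr) _.
  by rewrite leq_exp2r //; lia.
have npow e : n%:R ^+ e.+1 <= (b ^ e.+1)%:R * r%:R ^+ (4 * e.+1) :> rat.
  by rewrite -!natrX -natrM ler_nat expnM -expnMn leq_exp2r.
have rhor : 0 <= rho ^+ r by rewrite exprn_ge0.
pose tot := #|{: orientation k n}|.
have tot0 : 0 < tot%:R :> rat by rewrite ltr0n; apply/card_gt0P; exists [ffun=> true].
have star_small : #|star_events k n r|%:R <= eps / 2 * tot%:R.
  apply: le_trans (ratio_of_count p0 (card_star_events k n r)) _.
  (* Both the number of families and the decay are [r]-th powers, so they combine into [y ^+ r]. *)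
  rewrite -/rho -/w ler_pM2r // natrM exprM !natrX -mulrA -exprMn.
  set y := n%:R ^+ k.+1 * rho ^+ r.
  have y0 : 0 <= y by rewrite mulr_ge0 // exprn_ge0.
  have yd : y <= delta.
    apply: le_trans (h1 r hr1).
    exact: ler_wpM2r.
  have y1 : y <= 1 by apply: le_trans yd _; rewrite ge_min lexx.
  have yw : y <= eps / 2 / w%:R by apply: le_trans yd _; rewrite ge_min lexx orbT.
  apply: le_trans (_ : w%:R * y <= _).
    by rewrite ler_pM2l // ler_iXnr.
  by rewrite mulrC -ler_pdivlMr.
have block_small : #|block_events k n r (2 * d)|%:R <= eps / 2 * tot%:R.
  apply: le_trans (ratio_of_count p0 (card_block_events hk dr)) _.
  rewrite ler_pM2r // -/rho.
  apply: le_trans (h2 r hr2).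
  (* The number [2 * d] of blocks is bounded by [n], which makes the count of indices cubic in
     [n]. *)
  rewrite ler_wpM2r //; apply: le_trans (_ : (k ^ 3)%:R * n%:R ^+ 3 <= _).
    rewrite -natrX -natrM ler_nat.
    apply: leq_trans (_ : k * (k * n) * (k * n) * n <= _)%N.
      by rewrite leq_mul2l dn orbT.
    by rewrite (_ : k * (k * n) * (k * n) * n = k ^ 3 * n ^ 3)%N //; ring.
  by rewrite natrM -mulrA ler_wpM2l.
rewrite /prob_R ler_pdivlMr //.
set G := [set o | _].
have cG : (tot <= #|star_events k n r| + #|block_events k n r (2 * d)| + #|G|)%N.
  have sub : ~: (star_events k n r :|: block_events k n r (2 * d)) \subset G.
    apply/subsetP=> o; rewrite !inE negb_or => /andP[os ob].
    rewrite /pbool; case: excluded_middle_informative => // -[].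
    by apply: (good_of_events (r := r) (M := 2 * d)) os ob => //; apply: leq_trans dn; rewrite leq_pmull.
  rewrite /tot -(cardsC (star_events k n r :|: block_events k n r (2 * d))).
  by apply: leq_add (subset_leq_card sub); apply: (leq_card_setU _ _).1.
apply: le_of_halves star_small block_small.
by rewrite -!natrD ler_nat.
Qed.
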